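(* Let $\widehat Q^{(1)}_{n,m},\dots,\widehat Q^{(m)}_{n,m}$ be the subset-based variational posteriors computed on disjoint groups $G_1,\dots,G_m$; they are independent random probability measures on $\Theta$. Let $0\le\kappa<1/3$. Suppose $\epsilon>0$ is such that for every $j$ with $1\le j\le\lfloor(1-\kappa)m\rfloor+1$, \[ \Pr\big(d_{W_{1,\rho}}(\widehat Q^{(j)}_{n,m},\delta_0)>\epsilon\big)\le\tfrac14 . \] Here the indices $1,\dots,\lfloor(1-\kappa)m\rfloor+1$ label uncontaminated groups; the other groups are arbitrary. Then the Wasserstein metric median $Q^*_{\mathrm{Met}}$ satisfies \[ \Pr\big(d_{W_{1,\rho}}(Q^*_{\mathrm{Met}},\delta_0)>3\epsilon\big)\le\Big[e^{(1-\kappa)\psi\left(\frac{1/2-\kappa}{1-\kappa},\frac14\right)}\Big]^{-m}. \]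
   Context: $\Theta$ carries the Hellinger metric $\rho(\theta_1,\theta_2)=h(P_{\theta_1},P_{\theta_2})$, and $\delta_0$ is the Dirac measure at $\theta_0$. The distance \[ d_{W_{1,\rho}}(\mu_1,\mu_2)=\inf_{\gamma}\int\rho(x,y)\,d\gamma(x,y) \] is the 1-Wasserstein distance with respect to $\rho$, the infimum running over couplings $\gamma$ of $\mu_1,\mu_2$. The subset-based variational posterior is $\widehat Q^{(j)}_{n,m}=\arg\min_{Q\in\mathcal Q}\mathrm{KL}(Q,\Pi_{n,m}(\cdot\mid G_j))$, where \[ \Pi_{n,m}(B\mid G_j)\propto\int_B\Big(\prod_{i\in G_j}p_\theta(X_i)\Big)^m d\Pi(\theta). \] Wasserstein metric median: let \[ \varepsilon_*=\inf\Big\{\varepsilon>0:\ \exists\, j\in\{1,\dots,m\},\ I(j)\subset\{1,\dots,m\}\text{ with } |I(j)|>\tfrac m2 \text{ and } d_{W_{1,\rho}}(\widehat Q^{(i)}_{n,m},\widehat Q^{(j)}_{n,m})\le2\varepsilon\ \ \forall i\in I(j)\Big\}, \] let $j_*$ be a corresponding index (ties broken arbitrarily), and set $Q^*_{\mathrm{Met}}=\widehat Q^{(j_* )}_{n,m}$. Define $\psi(\alpha,q)=(1-\alpha)\log\frac{1-\alpha}{1-q}+\alpha\log\frac{\alpha}{q}$. *)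

(* Defs.v *)
From HB Require Import structures.
From mathcomp Require Import all_boot all_order all_algebra.
From mathcomp Require Import all_classical all_reals all_analysis.
Set Implicit Arguments. Unset Strict Implicit. Unset Printing Implicit Defensive.
Import Order.TTheory GRing.Theory Num.Theory.
Local Open Scope classical_set_scope.
Local Open Scope ring_scope.

Section Defs.
Context {R : realType}.

(* Hellinger distance between the model distributions P_theta1, P_theta2,
   given through densities p theta w.r.t. a dominating measure mu on X:
   h(P,Q) = ( \int (sqrt p - sqrt q)^2 dmu )^(1/2). *)
Definition hellinger_rho {dT dX} {Theta : measurableType dT}
  {X : measurableType dX} (mu : {measure set X -> \bar R})
  (p : Theta -> X -> R) (t1 t2 : Theta) : R :=
  Num.sqrt (fine (\int[mu]_x ((Num.sqrt (p t1 x) - Num.sqrt (p t2 x)) ^+ 2)%:E)%E).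

Definition coupling {dT} {Theta : measurableType dT}
  (mu1 mu2 : probability Theta R) (g : probability (Theta * Theta)%type R) : Prop :=
  forall A : set Theta, measurable A ->
    g (A `*` setT) = mu1 A /\ g (setT `*` A) = mu2 A.

Definition W1 {dT} {Theta : measurableType dT} (rho : Theta -> Theta -> R)
  (mu1 mu2 : probability Theta R) : \bar R :=
  ereal_inf [set (\int[g]_z (rho z.1 z.2)%:E)%E
            | g in [set g | coupling mu1 mu2 g]].

Definition median_good {dT} {Theta : measurableType dT} (rho : Theta -> Theta -> R)
  (m : nat) (Qs : 'I_m -> probability Theta R) (e : R) : Prop :=
  exists (j : 'I_m) (I : {set 'I_m}),
    (m%:R / 2 < #|I|%:R :> R) /\
    (forall i, i \in I -> (W1 rho (Qs i) (Qs j) <= (2 * e)%:E)%E).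

Definition eps_star {dT} {Theta : measurableType dT} (rho : Theta -> Theta -> R)
  (m : nat) (Qs : 'I_m -> probability Theta R) : R :=
  inf [set e | (0 < e :> R) /\ median_good rho Qs e].

Definition median_index {dT} {Theta : measurableType dT} (rho : Theta -> Theta -> R)
  (m : nat) (Qs : 'I_m -> probability Theta R) (j : 'I_m) : Prop :=
  exists I : {set 'I_m},
    (m%:R / 2 < #|I|%:R :> R) /\
    (forall i, i \in I ->
       (W1 rho (Qs i) (Qs j) <= (2 * eps_star rho Qs)%:E)%E).

(* mutual independence of random elements Q j : Omega -> pprobability Theta R
   (space of probability measures with its standard (Giry) sigma-algebra) *)
Definition mutually_independent {dO dT} {Omega : measurableType dO}
  {Theta : measurableType dT} (P : probability Omega R) (m : nat)
  (Q : 'I_m -> Omega -> pprobability Theta R) : Prop :=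
  (forall j, measurable_fun setT (Q j)) /\
  forall (J : {set 'I_m}) (B : 'I_m -> set (pprobability Theta R)),
    (forall j, measurable (B j)) ->
    P (\bigcap_(j in [set j | j \in J]) (Q j @^-1` B j)) =
    (\prod_(j in J) P (Q j @^-1` B j))%E.

Definition outer_prob {dO} {Omega : measurableType dO}
  (P : probability Omega R) (A : set Omega) : \bar R :=
  ereal_inf [set P B | B in [set B | measurable B /\ A `<=` B]].

Definition psi (a q : R) : R :=
  (1 - a) * ln ((1 - a) / (1 - q)) + a * ln (a / q).

End Defs.

(* Main.v *)
Require Import Defs.
From HB Require Import structures.
From mathcomp Require Import all_boot all_order all_algebra.
From mathcomp Require Import all_classical all_reals all_analysis measurable_realfun.
From mathcomp Require Import ring lra zify.
Import Order.TTheory GRing.Theory Num.Theory.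
Local Open Scope classical_set_scope.
Local Open Scope ring_scope.

(** Write I(q) for the integral of rho(., theta0) against q. The only optimal
    transport facts needed are W1(q, delta_theta0) = I(q),
    W1(q1, q2) <= I(q1) + I(q2) (product coupling) and I(q2) <= I(q1) + W1(q1, q2),
    so no gluing of couplings is required. If more than half of the Q_i have
    I(Q_i) <= eps, then eps_star <= eps, and the majority around the median
    meets the majority around theta0, whence I(Q_jstar) <= 3 eps. Otherwise, of
    the N >= (1 - kappa) m uncontaminated groups, at least N - m / 2 are far
    from theta0; Chernoff's bound with z = 3 - 6 kappa, the optimal choice
    3 alpha / (1 - alpha) for alpha = (1/2 - kappa) / (1 - kappa), gives the rate. *)

Lemma measurable_sqrtr (R : realType) : measurable_fun setT (@Num.sqrt R).
Proof. by apply: continuous_measurable_fun => x; exact: sqrt_continuous. Qed.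

(** * The Hellinger distance as a measurable pseudometric *)

Section hellinger.
Context {R : realType} {dT dX} {Theta : measurableType dT}
  {X : measurableType dX}.
Variables (mu : {measure set X -> \bar R}) (p : Theta -> X -> R).
Hypothesis mp : measurable_fun setT (fun z : Theta * X => p z.1 z.2).
Hypothesis p_ge0 : forall t x, 0 <= p t x.
Hypothesis p_int : forall t, (\int[mu]_x (p t x)%:E = 1)%E.

Let mpt t : measurable_fun setT (p t).
Proof.
apply: (measurableT_comp (f := fun z : Theta * X => p z.1 z.2)
  (g := fun x => (t, x)) mp).
exact: measurable_fun_pair.
Qed.

Let h t1 t2 x := Num.sqrt (p t1 x) - Num.sqrt (p t2 x).

Let mh t1 t2 : measurable_fun setT (h t1 t2).
Proof.
by apply: measurable_funB; apply: measurableT_comp => //; exact: measurable_sqrtr.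
Qed.

(** Pointwise (sqrt a - sqrt b)^2 <= a + b, so the integral is at most 2. Without finiteness, [fine]
    would send an infinite integral to 0 and the distance would no longer be the L2 norm. *)
Lemma sqr_hellinger_fin_num t1 t2 :
  (\int[mu]_x ((Num.sqrt (p t1 x) - Num.sqrt (p t2 x)) ^+ 2)%:E)%E
    \is a fin_num.
Proof.
rewrite ge0_fin_numE; last by apply: integral_ge0 => x _; rewrite lee_fin sqr_ge0.
apply: (@le_lt_trans _ _ (\int[mu]_x ((p t1 x)%:E + (p t2 x)%:E))%E).
  apply: ge0_le_integral => //.
  - by move=> x _; rewrite lee_fin sqr_ge0.
  - by apply/measurable_EFinP; apply: measurable_funX; exact: mh.
  - by apply: emeasurable_funD; apply/measurable_EFinP.
  - move=> x _; rewrite -EFinD lee_fin sqrrB !sqr_sqrtr// lerD2r gerBl.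
    by rewrite mulrn_wge0// mulr_ge0// sqrtr_ge0.
rewrite ge0_integralD//; do ?[exact/measurable_EFinP|by move=> x _; rewrite lee_fin].
by rewrite !p_int -EFinD ltry.
Qed.

(** In this form the triangle inequality is Minkowski's inequality for the differences of square
    roots of densities. *)
Lemma hellinger_rho_Lnorm t1 t2 :
  (hellinger_rho mu p t1 t2)%:E =
  'N[mu]_2%:E[EFin \o (fun x => Num.sqrt (p t1 x) - Num.sqrt (p t2 x))%R]%E.
Proof.
have -> : 'N[mu]_2%:E[EFin \o h t1 t2]%E =
   ((\int[mu]_x ((h t1 t2 x) ^+ 2)%:E) `^ 2^-1)%E.
  rewrite Lnorm.unlock; congr (_ `^ _)%E; apply: eq_integral => x _ /=.
  by rewrite powR_mulrn// real_normK// num_real.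
rewrite -(fineK (sqr_hellinger_fin_num t1 t2)) poweR_EFin powR12_sqrt//.
by rewrite fine_ge0// integral_ge0// => x _; rewrite lee_fin sqr_ge0.
Qed.

Lemma hellinger_rho_triangle t1 t2 t3 :
  hellinger_rho mu p t1 t3 <= hellinger_rho mu p t1 t2 + hellinger_rho mu p t2 t3.
Proof.
rewrite -lee_fin EFinD !hellinger_rho_Lnorm.
rewrite (@eq_Lnorm _ _ _ _ _ (EFin \o h t1 t3)
  (EFin \o (h t1 t2 \+ h t2 t3)%R)); last first.
  by move=> x /=; rewrite /h addrA subrK.
by apply: minkowski_EFin => //; rewrite ler1n.
Qed.

Lemma hellinger_rho_ge0 t1 t2 : 0 <= hellinger_rho mu p t1 t2.
Proof. exact: sqrtr_ge0. Qed.

Lemma hellinger_rho_refl t : hellinger_rho mu p t t = 0.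
Proof.
rewrite /hellinger_rho integral0_eq ?sqrtr0// => x _.
by rewrite subrr expr0n.
Qed.

Lemma hellinger_rhoC t1 t2 : hellinger_rho mu p t1 t2 = hellinger_rho mu p t2 t1.
Proof.
congr (Num.sqrt (fine _)); apply: eq_integral => x _; congr EFin.
by rewrite -sqrrN opprB.
Qed.

(** Joint measurability is what integration against couplings requires. It comes from Tonelli's
    theorem, with the pair of parameters as the outer variable. *)
Lemma measurable_hellinger_rho : sigma_finite setT mu ->
  measurable_fun setT (fun z : Theta * Theta => hellinger_rho mu p z.1 z.2).
Proof.
move=> mu_fin.
apply: (measurableT_comp (measurable_sqrtr R)).
apply: measurableT_comp; first exact: measurable_realfun.fine_measurable.
(* Tonelli's theorem expects a measure carrying the sigma-finite structure, so the hypothesis on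
   [mu] is packed into one. *)
pose mu_s := isSFinite.Build _ _ _ _ (sfinite_measure_sigma_finite mu_fin).
pose mu_sf := isSigmaFinite.Build _ _ _ _ mu_fin.
pose mu' : {sigma_finite_measure set X -> \bar R} :=
  HB.pack (Measure.sort mu) mu_s mu_sf.
pose f (z : (Theta * Theta) * X) : \bar R :=
  ((Num.sqrt (p z.1.1 z.2) - Num.sqrt (p z.1.2 z.2)) ^+ 2)%:E.
apply: (@measurable_fun_fubini_tonelli_F _ _ _ _ _ mu' f).
- apply/measurable_EFinP/measurable_funX/measurable_funB.
  + apply: (measurableT_comp (measurable_sqrtr R)).
    apply: (measurableT_comp (f := fun z : Theta * X => p z.1 z.2)
      (g := fun z : (Theta * Theta) * X => (z.1.1, z.2)) mp).
    apply: measurable_fun_pair => //.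
    exact: (measurableT_comp measurable_fst).
  + apply: (measurableT_comp (measurable_sqrtr R)).
    apply: (measurableT_comp (f := fun z : Theta * X => p z.1 z.2)
      (g := fun z : (Theta * Theta) * X => (z.1.2, z.2)) mp).
    apply: measurable_fun_pair => //.
    exact: (measurableT_comp measurable_snd).
- by move=> z; rewrite lee_fin sqr_ge0.
Qed.

End hellinger.

(** * The product of two probability measures *)

Section product_probability.
Context {d1 d2} {T1 : measurableType d1} {T2 : measurableType d2} {R : realType}.
Variables (m1 : probability T1 R) (m2 : probability T2 R).

Let prod := (m1 \x m2)%E.

HB.instance Definition _ := Measure.on prod.

Let prod_setT : prod setT = 1%E.
Proof.
rewrite -setXTT [LHS]product_measure1E//.
by rewrite [X in (X * _)%E](probability_setT m1)
  [X in (_ * X)%E](probability_setT m2) mule1.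
Qed.

HB.instance Definition _ := Measure_isProbability.Build _ _ _ prod prod_setT.

Definition product_probability : probability (T1 * T2)%type R := prod.

End product_probability.

(** * Wasserstein distance and the cost of transport to a point *)

Section wasserstein.
Context {R : realType} {d} {T : measurableType d}.
Implicit Types q : probability T R.

Lemma coupling_product q1 q2 : coupling q1 q2 (product_probability q1 q2).
Proof.
move=> A mA; rewrite /product_probability/=; split.
  by rewrite [LHS]product_measure1E// [X in (_ * X)%E](probability_setT q2) mule1.
by rewrite [LHS]product_measure1E// [X in (X * _)%E](probability_setT q1) mul1e.
Qed.

(** The first marginal is the pushforward of [g] under [fst], so this is a change of variables. *)
Lemma coupling_integral1 q1 q2 g (f : T -> \bar R) : coupling q1 q2 g ->
  measurable_fun setT f -> (forall x, 0 <= f x)%E ->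
  (\int[g]_z f z.1 = \int[q1]_x f x)%E.
Proof.
move=> gq mf f0.
rewrite [RHS](eq_measure_integral (pushforward g fst)); last first.
  move=> A mA _; rewrite /pushforward -[LHS](gq A mA).1; congr (g _).
  by apply/seteqP; split => -[x y]//= [].
by rewrite ge0_integral_pushforward.
Qed.

Lemma coupling_integral2 q1 q2 g (f : T -> \bar R) : coupling q1 q2 g ->
  measurable_fun setT f -> (forall x, 0 <= f x)%E ->
  (\int[g]_z f z.2 = \int[q2]_x f x)%E.
Proof.
move=> gq mf f0.
rewrite [RHS](eq_measure_integral (pushforward g snd)); last first.
  move=> A mA _; rewrite /pushforward -[LHS](gq A mA).2; congr (g _).
  by apply/seteqP; split => -[x y]//= [].
by rewrite ge0_integral_pushforward.
Qed.

Variables (rho : T -> T -> R) (t0 : T).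
Hypothesis mrho : measurable_fun setT (fun z : T * T => rho z.1 z.2).
Hypothesis rho_ge0 : forall x y, 0 <= rho x y.
Hypothesis rho_refl : forall x, rho x x = 0.
Hypothesis rhoC : forall x y, rho x y = rho y x.
Hypothesis rho_triangle : forall x y z, rho x z <= rho x y + rho y z.

Let mrho0 : measurable_fun setT (fun x => (rho x t0)%:E).
Proof.
apply/measurable_EFinP.
apply: (measurableT_comp (f := fun z : T * T => rho z.1 z.2)
  (g := fun x => (x, t0)) mrho).
exact: measurable_fun_pair.
Qed.

Lemma W1_ge0 q1 q2 : (0 <= W1 rho q1 q2)%E.
Proof.
apply: le_ereal_inf_tmp => _ [g _ <-]; apply: integral_ge0 => z _.
by rewrite lee_fin.
Qed.

Lemma W1_le_cost_add q1 q2 :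
  (W1 rho q1 q2 <= \int[q1]_x (rho x t0)%:E + \int[q2]_x (rho x t0)%:E)%E.
Proof.
have gq := coupling_product q1 q2; set g := product_probability q1 q2 in gq.
apply: (@le_trans _ _ (\int[g]_z (rho z.1 z.2)%:E)%E).
  by apply: ereal_inf_lbound; exists g.
rewrite -(coupling_integral1 _ _ _ _ gq)//.
  rewrite -(coupling_integral2 _ _ _ _ gq)//.
    rewrite -ge0_integralD//.
    - apply: ge0_le_integral => //.
      + by move=> z _; rewrite lee_fin.
      + exact/measurable_EFinP.
      + apply: emeasurable_funD.
          exact: (measurableT_comp mrho0).
        exact: (measurableT_comp mrho0).
      + by move=> z _; rewrite -EFinD lee_fin (rhoC z.2).
    - by move=> z _; rewrite lee_fin.
    - exact: (measurableT_comp mrho0).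
    - by move=> z _; rewrite lee_fin.
    - exact: (measurableT_comp mrho0).
  by move=> x; rewrite lee_fin.
by move=> x; rewrite lee_fin.
Qed.

(** Integrate rho(y, t0) <= rho(x, t0) + rho(x, y) against [g] and read off the marginals. *)
Lemma cost_le_coupling q1 q2 g : coupling q1 q2 g ->
  (\int[q2]_x (rho x t0)%:E <=
   \int[q1]_x (rho x t0)%:E + \int[g]_z (rho z.1 z.2)%:E)%E.
Proof.
move=> gq.
rewrite -(coupling_integral1 _ _ _ _ gq)//; last by move=> x; rewrite lee_fin.
rewrite -(coupling_integral2 _ _ _ _ gq)//; last by move=> x; rewrite lee_fin.
have m1 := measurableT_comp mrho0 (measurable_fst (T1 := T) (T2 := T)).
have m2 := measurableT_comp mrho0 (measurable_snd (T1 := T) (T2 := T)).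
rewrite -ge0_integralD//.
- apply: ge0_le_integral => //.
  + by move=> z _; rewrite lee_fin.
  + by apply: emeasurable_funD => //; exact/measurable_EFinP.
  + move=> z _; rewrite -EFinD lee_fin addrC (rhoC z.1 z.2).
    exact: rho_triangle.
- by move=> z _; rewrite lee_fin.
- by move=> z _; rewrite lee_fin.
- exact/measurable_EFinP.
Qed.

Lemma cost_le_coupling_sym q1 q2 g : coupling q1 q2 g ->
  (\int[q1]_x (rho x t0)%:E <=
   \int[q2]_x (rho x t0)%:E + \int[g]_z (rho z.1 z.2)%:E)%E.
Proof.
move=> gq.
rewrite -(coupling_integral2 _ _ _ _ gq)//; last by move=> x; rewrite lee_fin.
rewrite -(coupling_integral1 _ _ _ _ gq)//; last by move=> x; rewrite lee_fin.
have m1 := measurableT_comp mrho0 (measurable_fst (T1 := T) (T2 := T)).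
have m2 := measurableT_comp mrho0 (measurable_snd (T1 := T) (T2 := T)).
rewrite -ge0_integralD//.
- apply: ge0_le_integral => //.
  + by move=> z _; rewrite lee_fin.
  + by apply: emeasurable_funD => //; exact/measurable_EFinP.
  + move=> z _; rewrite -EFinD lee_fin addrC.
    exact: rho_triangle.
- by move=> z _; rewrite lee_fin.
- by move=> z _; rewrite lee_fin.
- exact/measurable_EFinP.
Qed.

Lemma cost_le_W1 q1 q2 :
  (\int[q2]_x (rho x t0)%:E <= \int[q1]_x (rho x t0)%:E + W1 rho q1 q2)%E.
Proof.
have I0 : (0 <= \int[q1]_x (rho x t0)%:E)%E.
  by apply: integral_ge0 => x _; rewrite lee_fin.
(* A finite cost can be subtracted, which leaves a lower bound to check for each coupling. An
   infinite cost makes the right-hand side infinite, since [W1] is nonnegative. *)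
have [Ifin|] := boolP ((\int[q1]_x (rho x t0)%:E)%E \is a fin_num).
  rewrite addeC -leeBlDr//; apply: le_ereal_inf_tmp => _ [g gq <-].
  by rewrite leeBlDr// addeC; exact: cost_le_coupling.
rewrite ge0_fin_numE// -leNgt leye_eq => /eqP ->.
rewrite addye ?leey// gt_eqF//; apply: (lt_le_trans _ (W1_ge0 _ _)).
exact: ltNy0.
Qed.

(** The Dirac measure has cost 0, so the product coupling gives one inequality and the bound valid
    for every coupling gives the other. *)
Lemma W1_dirac q : W1 rho q (\d_t0)%R = (\int[q]_x (rho x t0)%:E)%E.
Proof.
have I0 : (\int[(\d_t0 : probability T R)]_x (rho x t0)%:E = 0)%E.
  by rewrite integral_dirac// diracT mul1e rho_refl.
apply/eqP; rewrite eq_le; apply/andP; split.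
  by have := W1_le_cost_add q (\d_t0)%R; rewrite I0 adde0.
apply: le_ereal_inf_tmp => _ [g gq <-].
by have := cost_le_coupling_sym _ _ _ gq; rewrite I0 add0e.
Qed.

Lemma median_index_cost_le (m : nat) (Qs : 'I_m -> probability T R) (e : R)
    (j : 'I_m) :
  0 < e -> median_index rho Qs j ->
  m%:R / 2 < #|[set i | (\int[Qs i]_x (rho x t0)%:E <= e%:E)%E]%SET|%:R :> R ->
  (\int[Qs j]_x (rho x t0)%:E <= (3 * e)%:E)%E.
Proof.
move=> e0 [I [mI IW]]; set G := [set i | _]%SET => mG.
have le_star : eps_star rho Qs <= e.
  (* A member bounds the real [inf] from above only if the set is bounded below, here by 0.
     Membership of [e] is witnessed by [G] itself, with any of its elements as centre. *)
  apply: ge_inf; first by exists 0 => x [/ltW].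
  split=> //.
  have /card_gt0P[i iG] : (0 < #|G|)%N.
    by rewrite -(ltr_nat R); apply: le_lt_trans mG; rewrite divr_ge0.
  exists i, G; split => // i' i'G; move: iG i'G; rewrite !inE => Qi Qi'.
  apply: (le_trans (W1_le_cost_add _ _)).
  by rewrite mulr2n mulrDl mul1r EFinD leeD.
(* Two sets of more than m / 2 indices out of m must meet. *)
have /card_gt0P[i] : (0 < #|G :&: I|)%N.
  have := cardsUI G I; have := max_card (G :|: I)%SET; rewrite card_ord.
  move: mG mI; rewrite !ltr_pdivrMr// -!natrM !ltr_nat.
  by move: #|(_ :|: _)%SET| #|(_ :&: _)%SET| #|G| #|I| => a b c i; lia.
rewrite !inE => /andP[Qi iI].
apply: (le_trans (cost_le_W1 (Qs i) _)).
rewrite (_ : 3 * e = e + 2 * e); last by lra.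
rewrite EFinD leeD//; apply: (le_trans (IW _ iI)).
by rewrite lee_fin ler_pM2l.
Qed.

End wasserstein.

(** * Chernoff's bound for the number of independent events that occur *)

Section independent_events.
Context {d} {Omega : measurableType d} {R : realType}.
Variables (P : probability Omega R) (I : finType) (A : I -> set Omega).

(** Each event contributes a factor 1 + (z - 1) 1_A, and the product is expanded over subsets. A
    finite combination of indicators of intersections results, from which both measurability and the
    expectation are computed term by term. *)
Lemma expr_card_occurrences (z : R) (w : Omega) :
  z ^+ #|[set j | w \in A j]%SET| =
  \sum_(J : {set I}) (z - 1) ^+ #|J| * \1_(\bigcap_(j in [set` J]) A j) w.
Proof.
have -> : z ^+ #|[set j | w \in A j]%SET| =
    \prod_j ((z - 1) * \1_(A j) w + 1).
  rewrite -prodr_const big_mkcond/=; apply: eq_bigr => j _.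
  rewrite inE indicE; case: (w \in A j); first by rewrite mulr1 subrK.
  by rewrite mulr0 add0r.
rewrite bigA_distr; apply: eq_bigr => J _.
rewrite -big_mkcond/= big_split/= prodr_const; congr (_ * _).
rewrite indicE; have [wJ|wJ] := boolP (w \in _).
  rewrite big1// => j jJ; rewrite indicE mem_set//.
  by move: wJ; rewrite inE; apply.
have [j jJ wj] : exists2 j, j \in J & w \notin A j.
  apply: contrapT => h; move/negP: wJ; apply; rewrite inE => j /= jJ.
  apply: contrapT => wj; apply: h; exists j => //.
  by apply/negP; rewrite inE.
by rewrite (bigD1 j)//= indicE (negbTE wj) mul0r.
Qed.

Hypothesis mA : forall j, measurable (A j).

Let mcap (J : {set I}) : measurable (\bigcap_(j in [set` J]) A j).
Proof. by apply: fin_bigcap_measurable. Qed.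

Lemma measurable_expr_card_occurrences (z : R) :
  measurable_fun setT (fun w => z ^+ #|[set j | w \in A j]%SET|).
Proof.
under eq_fun do rewrite expr_card_occurrences.
by apply: measurable_sum => J; apply: measurable_funM.
Qed.

Lemma measurable_expr_card_occurrences_ge (z c : R) :
  measurable [set w | c <= z ^+ #|[set j | w \in A j]%SET|].
Proof.
rewrite -[X in measurable X]setTI; apply: measurable_fun_le => //.
exact: measurable_expr_card_occurrences.
Qed.

Hypothesis indepA : forall J : {set I},
  P (\bigcap_(j in [set` J]) A j) = (\prod_(j in J) P (A j))%E.

(** Independence factors the probability of each intersection, and the expansion over subsets then
    folds back into a product. The condition 1 <= z keeps all coefficients nonnegative. *)
Lemma expectation_expr_card_occurrences (z : R) : 1 <= z ->
  (\int[P]_w (z ^+ #|[set j | w \in A j]%SET|)%:E =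
   (\prod_j ((z - 1) * fine (P (A j)) + 1))%:E)%E.
Proof.
move=> z1.
under eq_integral do rewrite expr_card_occurrences -sumEFin.
rewrite ge0_integral_sum//; last 2 first.
- by move=> J; exact/measurable_EFinP/measurable_funM.
- by move=> J w _; rewrite lee_fin mulr_ge0// exprn_ge0// subr_ge0.
rewrite bigA_distr -sumEFin; apply: eq_bigr => J _.
under eq_integral do rewrite EFinM.
rewrite ge0_integralZl//; last 2 first.
- exact/measurable_EFinP/measurable_indic.
- by rewrite lee_fin exprn_ge0// subr_ge0.
rewrite integral_indic// setIT.
rewrite [X in (_ * X)%E](indepA J) -big_mkcond/= big_split/= prodr_const.
rewrite EFinM -prodEFin; congr (_ * _)%E; apply: eq_bigr => j _.
by rewrite fineK// fin_num_measure.
Qed.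

(** Markov's inequality for z to the number of occurrences. The threshold z^k is written with [expR]
    because k is real; it will be a count minus m / 2. *)
Lemma chernoff_card_occurrences (z k : R) : 1 <= z ->
  (P [set w | (expR (ln z * k) <= z ^+ #|[set j | w \in A j]%SET|)%R] <=
   (expR (- (ln z * k)) * \prod_j ((z - 1) * fine (P (A j)) + 1))%:E)%E.
Proof.
move=> z1; set B := [set w | _].
have z0 : 0 < z by rewrite (lt_le_trans _ z1).
have mB : measurable B by exact: measurable_expr_card_occurrences_ge.
rewrite EFinM -expectation_expr_card_occurrences// expRN.
have PB : (\int[P]_w (\1_B w)%:E = P B)%E by rewrite integral_indic// setIT.
rewrite lee_pdivlMl ?expR_gt0// -PB -ge0_integralZl//; last first.
  exact/measurable_EFinP/measurable_indic.
apply: ge0_le_integral => //.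
- exact/measurable_EFinP/measurable_funM.
- exact/measurable_EFinP/measurable_expr_card_occurrences.
- move=> w _; rewrite -EFinM lee_fin indicE.
  have [|_] := boolP (w \in B); first by rewrite inE mulr1.
  by rewrite mulr0 exprn_ge0// ltW.
Qed.

End independent_events.

(** The identity on [pprobability T R] is a probability kernel, and integrating against a kernel is
    measurable in its parameter. *)
Lemma measurable_integral_pprobability {d} {T : measurableType d} {R : realType}
    (f : T -> \bar R) : measurable_fun setT f -> (forall x, 0 <= f x)%E ->
  measurable_fun setT (fun q : pprobability T R => (\int[q]_x f x)%E).
Proof.
move=> mf f0.
pose k := kprobability (@measurable_id _ (pprobability T R) setT).
exact: (measurable_fun_integral_kernel (measurable_kernel k)).
Qed.

(** * The rate function and the optimised Chernoff exponent *)

Lemma mulr_psi_quarter (R : realType) (kappa : R) : kappa < 1 / 3 ->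
  (1 - kappa) * psi ((1 / 2 - kappa) / (1 - kappa)) (1 / 4) =
  (1 / 2 - kappa) * ln (3 - 6 * kappa) - (1 - kappa) * ln (3 * (1 - kappa) / 2).
Proof.
move=> k3; have k1 : 1 - kappa != 0 by rewrite gt_eqF//; lra.
have s0 : 0 < 3 * (1 - kappa) / 2 by lra.
have z0 : 0 < 3 - 6 * kappa by lra.
rewrite /psi.
(* Both ratios inside [psi] are expressed through z = 3 - 6 kappa and s = 3 (1 - kappa) / 2, where s
   = (z - 1) / 4 + 1 is the Chernoff factor of one group. *)
have -> : (1 - (1 / 2 - kappa) / (1 - kappa)) / (1 - 1 / 4) =
    (3 * (1 - kappa) / 2)^-1 by field.
have -> : (1 / 2 - kappa) / (1 - kappa) / (1 / 4) =
    (3 - 6 * kappa) / (3 * (1 - kappa) / 2) by field.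
rewrite lnV ?posrE// (@ln_div _ (3 - 6 * kappa)) ?posrE//.
move: (ln (3 - _)) (ln _) => a b.
by field.
Qed.

(** At N = (1 - kappa) m the two exponents agree. Each further group multiplies the left side by s /
    z, where s = 3 (1 - kappa) / 2 and z = 3 - 6 kappa, and s <= z amounts to kappa <= 1/3. *)
Lemma chernoff_exponent_le (R : realType) (kappa : R) (m N : nat) :
  0 <= kappa -> kappa < 1 / 3 -> (1 - kappa) * m%:R <= N%:R ->
  expR (- (ln (3 - 6 * kappa) * (N%:R - m%:R / 2))) *
    ((3 - 6 * kappa - 1) * (1 / 4) + 1) ^+ N <=
  expR ((1 - kappa) * psi ((1 / 2 - kappa) / (1 - kappa)) (1 / 4)) ^- m.
Proof.
move=> k0 k3 mN; set z := 3 - 6 * kappa.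
have -> : (z - 1) * (1 / 4) + 1 = 3 * (1 - kappa) / 2 by rewrite /z; lra.
have s0 : 0 < 3 * (1 - kappa) / 2 by lra.
have z0 : 0 < z by rewrite /z; lra.
rewrite mulr_psi_quarter// -expRM_natr -expRN -{1}(lnK s0) -expRM_natr -expRD.
rewrite ler_expR -/z.
have : ln (3 * (1 - kappa) / 2) <= ln z.
  by rewrite ler_ln ?posrE// /z; lra.
nra.
Qed.

(* The cap by [m] matters when [x = m], as [floor x + 1] then exceeds [m]. *)
Lemma card_ord_le_floor (R : realType) (x : R) (m : nat) : 0 <= x -> x <= m%:R ->
  x <= #|[set j : 'I_m | j%:R <= (Num.floor x)%:~R :> R]%SET|%:R.
Proof.
move=> x0 xm; have := floorD1_gt x; have := floor_ge0 x; rewrite x0.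
case: (Num.floor x) => // n _ xn.
have km : (minn m n.+1 <= m)%N by exact: geq_minl.
apply: (@le_trans _ _ (minn m n.+1)%:R).
  have [//|_] := leqP m n.+1; apply/ltW/(lt_le_trans xn).
  by rewrite -addn1 natrD intrD.
rewrite ler_nat -{1}(card_ord (minn m n.+1)).
have widen_inj : injective (widen_ord km).
  by move=> i j /(congr1 val) /= ij; exact: val_inj.
rewrite -(card_imset predT widen_inj); apply/subset_leq_card.
apply/fintype.subsetP => _ /imsetP[i _ ->]; rewrite inE /= ler_nat.
by have := ltn_ord i; rewrite leq_min ltnS => /andP[].
Qed.

(** * Concentration of the Wasserstein median *)

Theorem theorem6 (R : realType)
  (dT dX dO : measure_display)
  (Theta : measurableType dT) (X : measurableType dX) (Omega : measurableType dO)
  (mu : {measure set X -> \bar R}) (p : Theta -> X -> R)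
  (theta0 : Theta)
  (P : probability Omega R) (m : nat)
  (Q : 'I_m -> Omega -> pprobability Theta R)
  (kappa eps : R) (jstar : Omega -> 'I_m) :
  sigma_finite setT mu ->
  measurable_fun setT (fun z : Theta * X => p z.1 z.2) ->
  (forall t x, 0 <= p t x) ->
  (forall t, (\int[mu]_x (p t x)%:E = 1)%E) ->
  (0 < m)%N ->
  mutually_independent P Q ->
  0 <= kappa -> kappa < 1 / 3 ->
  0 < eps ->
  (forall j : 'I_m,
     (j%:R <= (Num.floor ((1 - kappa) * m%:R))%:~R :> R) ->
     (P [set w | (W1 (hellinger_rho mu p) (Q j w) (\d_theta0)%R > eps%:E)%E]
        <= (1 / 4)%:E)%E) ->
  (forall w, median_index (hellinger_rho mu p) (fun i => Q i w) (jstar w)) ->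
  (outer_prob P
     [set w | (W1 (hellinger_rho mu p) (Q (jstar w) w) (\d_theta0)%R
                > (3 * eps)%:E)%E]
   <= ((expR ((1 - kappa) * psi ((1 / 2 - kappa) / (1 - kappa)) (1 / 4))) ^- m)%:E)%E.
Proof.
move=> mu_fin mp p_ge0 p_int m_gt0 [mQ indepQ] k0 k3 e0 hQ jstarP.
have mrho := measurable_hellinger_rho mu p mp mu_fin.
have rho_ge0 := hellinger_rho_ge0 mu p.
have rho_tri := hellinger_rho_triangle mu p mp p_ge0 p_int.
have rho_C := hellinger_rhoC mu p.
have rho_refl := hellinger_rho_refl mu p.
set rho := hellinger_rho mu p in hQ jstarP mrho rho_ge0 rho_tri rho_C rho_refl *.
have W1E q : W1 rho q (\d_theta0)%R = (\int[q]_x (rho x theta0)%:E)%E.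
  exact: W1_dirac.
(* Ordinals start at 0, so this bound without + 1 selects the labels 1 to floor + 1, as far as they
   exist. *)
pose U := [set j : 'I_m | j%:R <= (Num.floor ((1 - kappa) * m%:R))%:~R :> R]%SET.
have cardU : (1 - kappa) * m%:R <= #|U|%:R.
  apply: card_ord_le_floor; first by rewrite mulr_ge0//; lra.
  by rewrite ler_piMl//; lra.
pose far := [set q : pprobability Theta R |
  (eps%:E < \int[q]_x (rho x theta0)%:E)%E].
have mfar : measurable far.
  rewrite -[X in measurable X]setTI; apply: emeasurable_fun_o_infty => //.
  apply: measurable_integral_pprobability; last by move=> x; rewrite lee_fin.
  apply/measurable_EFinP.
  apply: (measurableT_comp (f := fun z : Theta * Theta => rho z.1 z.2)
    (g := fun x => (x, theta0)) mrho).
  exact: measurable_fun_pair.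
(* Contaminated groups get the empty event, so that independence holds for
   the whole family while only the groups in [U] are counted. *)
pose B j := if j \in U then far else set0.
have mB j : measurable (B j) by rewrite /B; case: ifP.
pose A j := Q j @^-1` B j.
have mA j : measurable (A j).
  by rewrite -[X in measurable X]setTI; exact: mQ.
have indepA (J : {set 'I_m}) :
    P (\bigcap_(j in [set` J]) A j) = (\prod_(j in J) P (A j))%E.
  exact: indepQ.
set z := 3 - 6 * kappa.
have z1 : 1 <= z by rewrite /z; lra.
have := @chernoff_card_occurrences _ _ _ P _ A mA indepA z
  (#|U|%:R - m%:R / 2) z1.
set E := [set w | _] => PE.
(* [jstar] is an arbitrary selection, so the event about the median is only enclosed in the
   measurable event [E]. *)
apply: (@le_trans _ _ (P E)).
  apply: ereal_inf_lbound; exists E => //; split.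
    exact: measurable_expr_card_occurrences_ge.
  move=> w /=; rewrite W1E => far_median; rewrite /E/=.
  have z0 : 0 < z by rewrite (lt_le_trans _ z1).
  (* Comparing exponents, it remains to see that at least |U| - m / 2 of the events [A j] occur. *)
  rewrite -{2}(lnK z0) -expRM_natr ler_expR ler_wpM2l ?ln_ge0//.
  set G := [set i | (\int[Q i w]_x (rho x theta0)%:E <= eps%:E)%E]%SET.
  have Gm : #|G|%:R <= m%:R / 2 :> R.
    rewrite leNgt; apply/negP => mG; move: far_median; rewrite ltNge => /negP.
    by apply; exact: (median_index_cost_le rho theta0 mrho rho_ge0 rho_C rho_tri
      m (fun i => Q i w) eps).
  (* The events that occur are those of the uncontaminated groups far from [theta0]; at most m / 2
     groups are close. *)
  have -> : [set j | w \in A j]%SET = (U :\: G)%SET.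
    apply/setP => j; rewrite inE [RHS]inE [j \in G]inE -ltNge.
    apply/idP/idP.
      rewrite inE /A /B /=; case: ifPn => //= jU; rewrite andbT => h; exact: h.
    by case/andP => h jU; rewrite inE /A /B /= jU.
  have : (#|U| <= #|U :\: G| + #|G|)%N.
    rewrite -(cardsID G U) addnC leq_add2l.
    by apply/subset_leq_card/fintype.subsetP => x; rewrite inE => /andP[].
  rewrite -(ler_nat R) natrD; lra.
apply: (le_trans PE); rewrite lee_fin.
apply: (le_trans _ (chernoff_exponent_le R kappa m #|U| k0 k3 cardU)).
(* The power is spread over all m groups, with factor 1 outside [U], where [A j] is empty, so that
   the products compare factor by factor. *)
rewrite ler_pM2l ?expR_gt0// -prodr_const [leRHS]big_mkcond/=.
apply: ler_prod => j _; apply/andP; split.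
  by rewrite addr_ge0// mulr_ge0// ?subr_ge0// fine_ge0.
rewrite /A /B; case: ifPn => jU; last first.
  by rewrite preimage_set0 measure0 mulr0 add0r.
rewrite lerD2r ler_wpM2l ?subr_ge0//.
move: jU; rewrite inE => /hQ.
rewrite (_ : [set w | _] = Q j @^-1` far); last first.
  by apply/seteqP; split => w /=; rewrite W1E.
move=> hj; rewrite -lee_fin fineK//.
by rewrite fin_num_measure// -[X in measurable X]setTI; exact: mQ.
Qed.
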